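(* Let $L$ be a geometric lattice of rank $r+1$ and let $\Delta(L)$ be its order complex, with $h$-vector $(h_0,\dots,h_r)$. Then for every integer $i$ with $1\le i \le r/2$, $$h_{i-1}\le h_i \qquad\text{and}\qquad h_i\le h_{r-i}.$$
   Context: A geometric lattice is a finite graded atomic lattice whose rank function $\rho$ satisfies $\rho(x\vee y)+\rho(x\wedge y)\le \rho(x)+\rho(y)$. The order complex $\Delta(L)$ is the simplicial complex whose vertices are the elements of $L-\{\hat 0,\hat 1\}$ and whose faces are the chains $x_1<\dots<x_k$ in $L-\{\hat 0,\hat 1\}$; it is pure of dimension $r-1$ (facets have $r$ vertices). Let $f_i$ be the number of faces with $i$ vertices ($f_0=1$ for the empty face), $0\le i\le r$. The $h$-vector $(h_0,\dots,h_r)$ is defined by $\sum_{i=0}^r f_i (x-1)^{r-i}=\sum_{i=0}^r h_i x^{r-i}$. *)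

(* Defs.v *)
From HB Require Import structures.
From mathcomp Require Import all_boot all_order all_algebra.
Set Implicit Arguments. Unset Strict Implicit. Unset Printing Implicit Defensive.
Import Order.TTheory GRing.Theory Num.Theory.

Section GeomLattice.
Context {disp : Order.disp_t} {L : finTBLatticeType disp}.
Local Open Scope order_scope.

Definition covers (x y : L) : bool :=
  (x < y) && [forall z : L, ~~ ((x < z) && (z < y))].

Definition is_rank_fun (rho : L -> nat) : Prop :=
  rho \bot = 0%N /\ forall x y : L, covers x y -> rho y = (rho x).+1.

Definition atom (a : L) : bool := covers \bot a.

Definition atomic : Prop :=
  forall x : L, x = \join_(a : L | atom a && (a <= x)) a.

Definition semimodular_rank (rho : L -> nat) : Prop :=
  forall x y : L, (rho (x `|` y) + rho (x `&` y) <= rho x + rho y)%N.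

Definition geometric (rho : L -> nat) : Prop :=
  [/\ is_rank_fun rho, atomic & semimodular_rank rho].

(* vertices of the order complex: L - {bot, top} *)
Definition proper_part : {set L} := [set x : L | (x != \bot) && (x != \top)].

Definition is_chain (S : {set L}) : bool :=
  [forall x in S, [forall y in S, (x <= y) || (y <= x)]].

(* f_i = number of faces (chains in the proper part) with i vertices *)
Definition fnum (i : nat) : nat :=
  #|[set S : {set L} | [&& S \subset proper_part, is_chain S & #|S| == i]]|.

Definition fpoly (r : nat) : {poly int} :=
  (\sum_(i < r.+1) (fnum i)%:R *: ('X - 1) ^+ (r - i))%R.

Definition hnum (r k : nat) : int := (fpoly r)`_(r - k).

End GeomLattice.

(* Main.v *)
Require Import Defs.
From HB Require Import structures.
From mathcomp Require Import all_boot all_order all_algebra.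
From mathcomp Require Import zify.
Import Order.TTheory GRing.Theory Num.Theory.
Set Implicit Arguments. Unset Strict Implicit. Unset Printing Implicit Defensive.

(** Order the atoms and label a covering [x < y] by the first atom below [y] and
    not below [x].  The label word of a maximal chain determines the chain, and
    [h_i] counts the maximal chains whose word has [i] descents: every face is
    completed greedily to a maximal chain, always adding the first new atom.
    Exchanging the two letters of an ascent of a label word gives again a label
    word.  Foata-Strehl hops, which move a double ascent rightwards over larger
    letters, are compositions of such exchanges.  They split the words into
    Boolean lattices graded by descents and centred at [r/2], each of which meets
    the set of label words in an up-set; double counting in each of them gives
    [h_i <= h_(i+k)] whenever [2i + k <= r]. *)

(** * Words and increasing trees *)

Fixpoint des (w : seq nat) : nat :=
  if w is a :: w' then (if w' is b :: _ then (b < a) + des w' else 0) else 0.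

Fixpoint asc (w : seq nat) : nat :=
  if w is a :: w' then (if w' is b :: _ then (a < b) + asc w' else 0) else 0.

Lemma asc_des w : uniq w -> asc w + des w = (size w).-1.
Proof.
elim: w => //= a [|b w] // IH /andP[]; rewrite inE negb_or => /andP[ab _].
move=> /IH /= <-; move: ab; rewrite neq_ltn; case: ltngtP => //= _ _; lia.
Qed.

(** The least letter [m] ends a descent if some letter precedes it, and never starts one. *)
Lemma des_cat_min u m v :
  all (ltn m) u -> all (ltn m) v ->
  des (u ++ m :: v) = des u + (u != [::]) + des v.
Proof.
move=> + hv.
have {hv} hm : des (m :: v) = des v.
  by case: v hv => //= b v /andP[hb _]; rewrite ltnNge (ltnW hb).
elim: u => [|a [|b u] IH]; first by rewrite cat0s hm.
  by move=> /= /andP[-> _]; move: hm => /= ->.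
by move=> /andP[_ /IH] /= ->; rewrite !addnA.
Qed.

Inductive tree := Leaf | Node of tree & nat & tree.

Fixpoint encode_tree (t : tree) : GenTree.tree nat :=
  if t is Node l x r then GenTree.Node x.+1 [:: encode_tree l; encode_tree r]
  else GenTree.Node 0 [::].

Fixpoint decode_tree (t : GenTree.tree nat) : tree :=
  if t is GenTree.Node x.+1 [:: l; r] then Node (decode_tree l) x (decode_tree r)
  else Leaf.

Lemma encode_treeK : cancel encode_tree decode_tree.
Proof. by elim=> //= l -> x r ->. Qed.

HB.instance Definition _ := Equality.copy tree (can_type encode_treeK).

Definition leaf (t : tree) : bool := if t is Leaf then true else false.

Fixpoint inorder (t : tree) : seq nat :=
  if t is Node l x r then inorder l ++ x :: inorder r else [::].

Fixpoint heap (t : tree) : bool :=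
  if t is Node l x r then
    [&& all (ltn x) (inorder l), all (ltn x) (inorder r), heap l & heap r]
  else true.

(** Prepends [x] to the inorder word: [x] goes down the left spine to the first larger label and
    takes the subtree found there as right child. *)
Fixpoint ins (x : nat) (t : tree) : tree :=
  if t is Node l y r then
    if x < y then Node Leaf x t else Node (ins x l) y r
  else Node Leaf x Leaf.

Definition tree_of (w : seq nat) : tree := foldr ins Leaf w.

Lemma inorder_ins x t : inorder (ins x t) = x :: inorder t.
Proof. by elim: t => //= l IHl y r _; case: ltnP => //= _; rewrite IHl. Qed.

Lemma tree_ofK : cancel tree_of inorder.
Proof. by elim=> //= x w IH; rewrite inorder_ins IH. Qed.

Lemma heap_ins x t : heap t -> x \notin inorder t -> heap (ins x t).
Proof.
elim: t => //= l IHl y r _ /and4P[hl hr Hl Hr].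
rewrite mem_cat inE !negb_or => /and3P[xl xy _].
case: ltnP => [lt|le] /=; last first.
  by rewrite inorder_ins /= hl hr Hr IHl // ltn_neqAle eq_sym xy le.
rewrite hl hr Hl Hr /= andbT all_cat /= lt /=.
have sub u : all (ltn y) u -> all (ltn x) u by apply: sub_all => z; apply: ltn_trans.
by rewrite !sub.
Qed.

Lemma heap_tree_of w : uniq w -> heap (tree_of w).
Proof.
by elim: w => //= x w IH /andP[xw /IH hw]; apply: heap_ins; rewrite ?tree_ofK.
Qed.

Lemma foldr_ins_Node s l y r :
  all (ltn y) s -> foldr ins (Node l y r) s = Node (foldr ins l s) y r.
Proof.
by elim: s => //= x s IH /andP[yx /IH ->] /=; rewrite ltnNge (ltnW yx).
Qed.

Lemma inorderK t : heap t -> tree_of (inorder t) = t.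
Proof.
elim: t => //= l IHl y r IHr /and4P[hl hr /IHl {}IHl /IHr {}IHr].
rewrite /tree_of foldr_cat /= -/(tree_of _) IHr.
have -> : ins y r = Node Leaf y r.
  by case: r hr {IHr} => //= a b c; rewrite all_cat /= => /and3P[_ -> _].
by rewrite foldr_ins_Node // -/(tree_of _) IHl.
Qed.

(* In the increasing tree of a word, the nodes with two children, with only a
   left child and with only a right child are respectively the valleys, the
   double descents and the double ascents. *)
Fixpoint nboth (t : tree) : nat :=
  if t is Node l _ r then nboth l + nboth r + (~~ leaf l && ~~ leaf r) else 0.

Fixpoint nleft (t : tree) : nat :=
  if t is Node l _ r then nleft l + nleft r + (~~ leaf l && leaf r) else 0.

Fixpoint nright (t : tree) : nat :=
  if t is Node l _ r then nright l + nright r + (leaf l && ~~ leaf r) else 0.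

(** Every node except the root is the child of exactly one node. *)
Lemma size_inorder t : ~~ leaf t ->
  size (inorder t) = (nboth t).*2.+1 + nleft t + nright t.
Proof.
elim: t => //= l IHl x r IHr _; rewrite size_cat /=.
have leaf0 t : leaf t -> t = Leaf by case: t.
have [/leaf0 ->|/IHl ->] := boolP (leaf l);
  have [/leaf0 ->|/IHr ->] := boolP (leaf r) => /=; lia.
Qed.

Lemma inorder_eq0 t : (inorder t == [::]) = leaf t.
Proof. by case: t => //= l x r; case: (inorder l). Qed.

(** A letter ends a descent exactly when its node has a left child: otherwise its predecessor, if
    any, is a smaller ancestor. *)
Lemma des_inorder t : heap t -> des (inorder t) = nboth t + nleft t.
Proof.
elim: t => //= l IHl x r IHr /and4P[hl hr /IHl Hl /IHr Hr].
by rewrite des_cat_min // Hl Hr inorder_eq0; case: (leaf l); case: (leaf r) => /=; lia.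
Qed.

(* [ups] and [downs] list the results of one Foata-Strehl hop. *)
Fixpoint ups (t : tree) : seq tree :=
  if t is Node l x r then
    [seq Node l' x r | l' <- ups l] ++ [seq Node l x r' | r' <- ups r] ++
    (if leaf l && ~~ leaf r then [:: Node r x Leaf] else [::])
  else [::].

Fixpoint downs (t : tree) : seq tree :=
  if t is Node l x r then
    [seq Node l' x r | l' <- downs l] ++ [seq Node l x r' | r' <- downs r] ++
    (if ~~ leaf l && leaf r then [:: Node Leaf x l] else [::])
  else [::].

Lemma size_ups t : size (ups t) = nright t.
Proof.
elim: t => //= l IHl x r IHr.
by rewrite !size_cat !size_map IHl IHr addnA; case: ifP.
Qed.

Lemma size_downs t : size (downs t) = nleft t.
Proof.
elim: t => //= l IHl x r IHr.
by rewrite !size_cat !size_map IHl IHr addnA; case: ifP.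
Qed.

Lemma Node_eqE l x r l' x' r' :
  (Node l x r == Node l' x' r') = [&& l == l', x == x' & r == r'].
Proof.
by apply/eqP/and3P => [[-> -> ->]|[/eqP -> /eqP -> /eqP ->]].
Qed.

Lemma count_map_Nodel l x r y r' s :
  count_mem (Node l x r) [seq Node l' y r' | l' <- s] =
  (if (x == y) && (r == r') then count_mem l s else 0).
Proof.
rewrite count_map; case: ifP => h; last first.
  rewrite -(count_pred0 s); apply: eq_count => z /=.
  by rewrite Node_eqE (eq_sym y) (eq_sym r') h andbF.
by apply: eq_count => z /=; rewrite Node_eqE (eq_sym y) (eq_sym r') h andbT.
Qed.

Lemma count_map_Noder l x r l' y s :
  count_mem (Node l x r) [seq Node l' y r' | r' <- s] =
  (if (x == y) && (l == l') then count_mem r s else 0).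
Proof.
rewrite count_map; case: ifP => h; last first.
  rewrite -(count_pred0 s); apply: eq_count => z /=.
  by rewrite Node_eqE (eq_sym y) (eq_sym l') andbA (andbC (l == _)) h.
by apply: eq_count => z /=; rewrite Node_eqE (eq_sym y) (eq_sym l') andbA (andbC (l == _)) h.
Qed.

Lemma leaf_ups t t' : t' \in ups t -> leaf t' = leaf t.
Proof.
case: t => //= l x r; rewrite !mem_cat => /or3P[/mapP[? _ ->]|/mapP[? _ ->]|] //.
by case: ifP => //; rewrite inE => _ /eqP ->.
Qed.

Lemma leaf_downs t t' : t' \in downs t -> leaf t' = leaf t.
Proof.
case: t => //= l x r; rewrite !mem_cat => /or3P[/mapP[? _ ->]|/mapP[? _ ->]|] //.
by case: ifP => //; rewrite inE => _ /eqP ->.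
Qed.

(** Downward hops reverse upward ones, with multiplicity; the double counting rests on this
    symmetry. *)
Lemma count_ups_downs t t' : count_mem t' (ups t) = count_mem t (downs t').
Proof.
elim: t t' => [|l IHl x r IHr] [|l' x' r'] //.
- by apply/esym/count_memPn/negP => /leaf_downs.
- by apply/count_memPn/negP => /leaf_ups.
rewrite /= !count_cat !count_map_Nodel !count_map_Noder IHl IHr.
rewrite (eq_sym x' x) (eq_sym r' r) (eq_sym l' l).
congr (_ + (_ + _)).
case: l {IHl} => [|? ? ?]; case: r {IHr} => [|? ? ?];
  case: l' => [|? ? ?]; case: r' => [|? ? ?] //=;
  rewrite ?Node_eqE ?andbF ?andbT //=.
rewrite andbC (eq_sym x); congr (nat_of_bool (_ && _) + _).
by congr [&& _, _ & _]; rewrite eq_sym.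
Qed.

Lemma ups_stat t t' :
  t' \in ups t -> nboth t' = nboth t /\ nleft t' = (nleft t).+1.
Proof.
elim: t t' => //= l IHl x r IHr t'; rewrite !mem_cat => /or3P[].
- move=> /mapP[l' hl' ->] /=; have [-> ->] := IHl _ hl'.
  by rewrite (leaf_ups hl'); split; lia.
- move=> /mapP[r' hr' ->] /=; have [-> ->] := IHr _ hr'.
  by rewrite (leaf_ups hr'); split; lia.
case: ifP => // /andP[hl hr]; rewrite inE => /eqP -> /=.
by case: l hl {IHl} => //= _; rewrite hr /=; split; lia.
Qed.

(** * Hops as compositions of exchanges *)

Definition swap_closed (W : pred (seq nat)) :=
  forall p a b s, a < b -> W (p ++ a :: b :: s) -> W (p ++ b :: a :: s).

Lemma swap_closed_move (W : pred (seq nat)) p x u s :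
  swap_closed W -> all (ltn x) u -> W (p ++ x :: u ++ s) -> W (p ++ u ++ x :: s).
Proof.
move=> cW; elim: u p => //= a u IH p /andP[xa hu] /(cW _ _ _ _ xa) h.
by rewrite -cat_rcons; apply: IH; rewrite // cat_rcons.
Qed.

Lemma mem_inorder_ups t t' : t' \in ups t -> inorder t' =i inorder t.
Proof.
elim: t t' => //= l IHl x r IHr t'; rewrite !mem_cat => /or3P[].
- by move=> /mapP[l' /IHl hl' ->] y /=; rewrite !mem_cat hl'.
- by move=> /mapP[r' /IHr hr' ->] y /=; rewrite !(mem_cat, inE) hr'.
case: ifP => // /andP[hl hr]; rewrite inE => /eqP -> y /=.
by case: l hl {IHl} => //= _; rewrite !(mem_cat, inE) orbC.
Qed.

Lemma heap_ups t t' : heap t -> t' \in ups t -> heap t'.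
Proof.
elim: t t' => //= l IHl x r IHr t' /and4P[hl hr Hl Hr]; rewrite !mem_cat => /or3P[].
- move=> /mapP[l' hl' ->] /=.
  by rewrite (eq_all_r (mem_inorder_ups hl')) hl hr Hr IHl.
- move=> /mapP[r' hr' ->] /=.
  by rewrite (eq_all_r (mem_inorder_ups hr')) hl hr Hl IHr.
by case: ifP => // /andP[_ _]; rewrite inE => /eqP -> /=; rewrite hr Hr.
Qed.

(** A hop at a node [x] with only a right subtree moves [x] past the larger letters of that subtree.
    The words [p] and [s] carry the context of the subtree through the induction. *)
Lemma swap_closed_ups (W : pred (seq nat)) t t' p s :
  swap_closed W -> heap t -> t' \in ups t ->
  W (p ++ inorder t ++ s) -> W (p ++ inorder t' ++ s).
Proof.
move=> cW; elim: t t' p s => //= l IHl x r IHr t' p s /and4P[hl hr Hl Hr].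
rewrite !mem_cat => /or3P[].
- by move=> /mapP[l' hl' ->] /=; rewrite -!catA; apply: IHl.
- move=> /mapP[r' hr' ->] /=; rewrite -!catA !cat_cons.
  by rewrite !(catA p) -!cat_rcons; apply: IHr.
case: ifP => // /andP[]; case: l {IHl hl Hl} => //= _ _; rewrite inE => /eqP -> /=.
by rewrite -catA; apply: swap_closed_move.
Qed.

Lemma sum_seq_const (T : Type) (s : seq T) c : \sum_(x <- s) c = size s * c.
Proof. by rewrite big_const_seq count_predT iter_addn_0 mulnC. Qed.

Lemma sum_count_mem (T : eqType) (s u : seq T) :
  uniq s -> \sum_(x <- s) count_mem x u = count (mem s) u.
Proof.
move=> us; elim: u => [|y u IH] /=; first by rewrite big1.
rewrite big_split /= IH -(count_uniq_mem y us); congr (_ + _).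
rewrite -sum1_count [in RHS]big_mkcond /=.
by apply: eq_bigr => x _; rewrite eq_sym; case: eqP.
Qed.

Lemma ffact_leq m n k : m <= n -> m ^_ k <= n ^_ k.
Proof.
by elim: k m n => [|k IH] [|m] [|n] // h; rewrite !ffactSS leq_mul // IH.
Qed.

(** * Sets of words closed under exchanging ascents *)

Section Count.
Variables (W : seq (seq nat)) (n : nat).
Hypothesis uW : uniq W.
Hypothesis uniqW : forall w, w \in W -> uniq w.
Hypothesis sizeW : forall w, w \in W -> size w = n.+1.
Hypothesis closedW : swap_closed (mem W).

Let forest := [seq tree_of w | w <- W].

Lemma uniq_forest : uniq forest.
Proof. by rewrite map_inj_uniq //; apply: can_inj tree_ofK. Qed.

Lemma forestP t : t \in forest -> heap t /\ inorder t \in W.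
Proof.
by move=> /mapP[w hw ->]; rewrite tree_ofK hw heap_tree_of ?uniqW.
Qed.

Lemma forest_ups t t' : t \in forest -> t' \in ups t -> t' \in forest.
Proof.
move=> /forestP[ht wt] tt'; rewrite -(inorderK (heap_ups ht tt')); apply: map_f.
have := @swap_closed_ups (mem W) t t' [::] [::] closedW ht tt'.
by rewrite /= !cats0; apply.
Qed.

(** Hops keep [v] and change [j] by one, so all Boolean lattices of rank [n - v.*2] are treated at
    once, [j] being the height in them. *)
Let level v j := [seq t <- forest | (nboth t == v) && (nleft t == j)].

Lemma nright_level v j t : t \in level v j -> nright t = n - v.*2 - j.
Proof.
rewrite mem_filter => /andP[/andP[/eqP vt /eqP jt] /forestP[_ /sizeW]].
have [|lt] := boolP (leaf t); first by case: t {vt jt}.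
by rewrite size_inorder // vt jt; lia.
Qed.

(** Double counting of hops between consecutive levels: all [n - v.*2 - j] upward hops stay in
    [forest], while some of the [j.+1] downward hops may leave it. *)
Lemma level_step v j :
  size (level v j) * (n - v.*2 - j) <= size (level v j.+1) * j.+1.
Proof.
rewrite -!sum_seq_const.
have -> : \sum_(t <- level v j) (n - v.*2 - j) =
          \sum_(t <- level v j) \sum_(t' <- level v j.+1) count_mem t' (ups t).
  rewrite big_seq [RHS]big_seq; apply: eq_bigr => t ht.
  rewrite -(nright_level ht) -size_ups sum_count_mem ?filter_uniq ?uniq_forest //.
  apply/esym/eqP; rewrite -all_count; apply/allP => t' tt' /=.
  move: ht; rewrite !mem_filter => /andP[/andP[/eqP vt /eqP jt] tf].
  have [-> ->] := ups_stat tt'.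
  by rewrite vt jt !eqxx (forest_ups tf tt').
rewrite exchange_big /= big_seq [X in _ <= X]big_seq; apply: leq_sum => t' ht'.
under eq_bigr do rewrite count_ups_downs.
rewrite sum_count_mem ?filter_uniq ?uniq_forest //.
rewrite (leq_trans (count_size _ _)) // size_downs.
by move: ht'; rewrite mem_filter => /andP[/andP[_ /eqP ->]].
Qed.

Lemma level_ffact v j k :
  size (level v j) * (n - v.*2 - j) ^_ k <= size (level v (j + k)) * (j + k) ^_ k.
Proof.
elim: k => [|k IH]; first by rewrite addn0 !ffactn0.
rewrite ffactnSr mulnA addnS ffactSS (leq_trans (leq_mul IH (leqnn _))) //.
rewrite mulnAC mulnA leq_mul2r -subnDA.
by rewrite level_step orbT.
Qed.

(** The hypothesis says [j + k <= n - v.*2 - j], which compares the two falling factorials in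
    [level_ffact]. *)
Lemma level_le v j k :
  j.*2 + k <= n - v.*2 -> size (level v j) <= size (level v (j + k)).
Proof.
move=> h; have h0 : 0 < (j + k) ^_ k by rewrite ffact_gt0 leq_addl.
rewrite -(leq_pmul2r h0) (leq_trans _ (level_ffact v j k)) // leq_mul2l.
by rewrite ffact_leq ?orbT //; lia.
Qed.

Lemma count_des_level i :
  count (fun w => des w == i) W = \sum_(v < i.+1) size (level v (i - v)).
Proof.
transitivity (count (fun t => nboth t + nleft t == i) forest).
  rewrite count_map; apply: eq_in_count => w hw /=.
  by rewrite -des_inorder ?tree_ofK // heap_tree_of // uniqW.
under eq_bigr do rewrite size_filter -sum1_count big_mkcond /=.
rewrite exchange_big /= -sum1_count big_mkcond /=; apply: eq_bigr => t _.
case: ifPn => h.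
  have hv : nboth t < i.+1 by lia.
  rewrite (bigD1 (Ordinal hv)) //= eqxx big1 => [|v vt]; first by case: eqP => //; lia.
  case: ifP => // /andP[/eqP e _]; case/eqP: vt; exact: val_inj.
rewrite big1 // => v _; case: ifP => // /andP[/eqP e1 /eqP e2].
by have := ltn_ord v; lia.
Qed.

Lemma count_des_le i k :
  i.*2 + k <= n -> count (fun w => des w == i) W <= count (fun w => des w == i + k) W.
Proof.
move=> h; rewrite !count_des_level.
rewrite -(big_mkord xpredT (fun v => size (level v (i - v)))).
rewrite -(big_mkord xpredT (fun v => size (level v (i + k - v)))).
(* The terms with [v > i] are dropped. For the others [j = i - v], and the condition of [level_le]
   becomes [i.*2 + k <= n], whatever [v] is. *)
rewrite [X in _ <= X](big_cat_nat (n := i.+1)) //=; last by lia.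
rewrite (leq_trans _ (leq_addr _ _)) //.
rewrite big_nat [X in _ <= X]big_nat; apply: leq_sum => v /andP[_ vi].
have -> : i + k - v = i - v + k by lia.
by apply: level_le; lia.
Qed.
End Count.

(** * Label words of geometric lattices *)

Section GeometricLattice.
Context {disp : Order.disp_t} {L : finTBLatticeType disp}.
Variable rho : L -> nat.
Hypothesis geomL : geometric rho.

Local Notation "x <=% y" := (@Order.le disp L x y) (at level 70).
Local Notation "x <% y" := (@Order.lt disp L x y) (at level 70).
Local Notation "x \v y" := (@Order.join disp L x y) (at level 50, left associativity).
Local Notation bot := (@Order.bottom disp L).
Local Notation top := (@Order.top disp L).

(** * Coverings and ranks *)

Lemma coversW (x y : L) : covers x y -> x <% y.
Proof. by case/andP. Qed.

Lemma rho_covers (x y : L) : covers x y -> rho y = (rho x).+1.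
Proof. by case: geomL => -[_ h] _ _; apply: h. Qed.

Lemma covers_le (x y : L) : x <% y -> exists2 z, covers x z & z <=% y.
Proof.
have [n] := ubnP #|[set z | (x <% z) && (z <% y)]|.
elim: n y => // n IH y hn xy.
have [c|] := boolP (covers x y); first by exists y.
rewrite /covers xy /= negb_forall => /existsP[z]; rewrite negbK => /andP[xz zy].
have [||t ct tz] := IH z; last by exists t => //; exact: le_trans tz (ltW zy).
  rewrite -ltnS; apply: leq_trans hn; rewrite ltnS; apply: proper_card; apply/properP; split.
    by apply/subsetP => t; rewrite !inE => /andP[-> /lt_trans]; apply.
  by exists z; rewrite !inE ?xz ?zy // ltxx andbF.
by [].
Qed.

Lemma rho_lt (x y : L) : x <% y -> rho x < rho y.
Proof.
have [n] := ubnP #|[set z | x <% z]|.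
elim: n x => // n IH x hn xy.
have [z cz zy] := covers_le xy.
rewrite -(rho_covers cz); move: zy; rewrite le_eqVlt => /orP[/eqP -> //|zy].
apply/ltnW/IH => //; rewrite -ltnS; apply: leq_trans hn; rewrite ltnS; apply: proper_card; apply/properP; split.
  by apply/subsetP => t; rewrite !inE; apply: lt_trans (coversW cz).
by exists z; rewrite !inE ?ltxx // coversW.
Qed.

Lemma lt_top (x : L) : rho x < rho top -> x <% top.
Proof. by rewrite ltx1; apply: contraTneq => ->; rewrite ltnn. Qed.

Lemma covers_rho (x y : L) : x <% y -> rho y <= (rho x).+1 -> covers x y.
Proof.
move=> xy h; rewrite /covers xy /=; apply/forallP => z; apply/negP.
by move=> /andP[/rho_lt a /rho_lt b]; lia.
Qed.

Lemma covers_between (x y z : L) : covers x y -> x <% z -> z <=% y -> z = y.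
Proof.
move=> /andP[_ /forallP/(_ z)] h xz; rewrite le_eqVlt => /orP[/eqP //|zy].
by rewrite xz zy in h.
Qed.

(** Semimodularity enters here: joining an atom raises the rank by at most one. *)
Lemma covers_join_atom (x a : L) : atom a -> ~~ (a <=% x) -> covers x (x \v a).
Proof.
move=> aa ax; apply: covers_rho.
  rewrite lt_neqAle leUl andbT; apply: contra ax => /eqP ->; exact: leUr.
case: geomL => -[rho0 _] _ /(_ x a); rewrite (rho_covers aa) rho0; lia.
Qed.

Lemma covers_join_eq (x y a : L) :
  covers x y -> a <=% y -> ~~ (a <=% x) -> x \v a = y.
Proof.
move=> c ay ax; apply: (covers_between c); last by rewrite leUx ay ltW // coversW.
rewrite lt_neqAle leUl andbT; apply: contra ax => /eqP ->; exact: leUr.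
Qed.

(** * Labels and label words *)

Lemma atom_separates (x y : L) :
  ~~ (y <=% x) -> exists a : L, [&& atom a, a <=% y & ~~ (a <=% x)].
Proof.
move=> yx; apply/existsP; apply: contraR yx; rewrite negb_exists => /forallP h.
case: geomL => _ /(_ y) -> _; apply/joinsP => a /andP[aa ay].
by move: (h a); rewrite aa ay /= negbK.
Qed.

(* Out of range indices give [bot], which is not an atom. *)
Definition at_ (k : nat) : L := nth bot (enum L) k.

Definition new_atom (x y : L) : pred L :=
  [pred a | [&& atom a, a <=% y & ~~ (a <=% x)]].

(** Defined for all pairs, since the greedy completion aims at a [y] that need not cover [x]. *)
Definition lab (x y : L) : nat := find (new_atom x y) (enum L).

Lemma labP (x y : L) : ~~ (y <=% x) -> new_atom x y (at_ (lab x y)).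
Proof.
move=> /atom_separates[a ha]; apply: nth_find; apply/hasP.
by exists a; rewrite ?mem_enum.
Qed.

Lemma lab_min (x y : L) k : new_atom x y (at_ k) -> lab x y <= k.
Proof. by move=> h; rewrite leqNgt; apply/negP => /(before_find bot); rewrite h. Qed.

Lemma lab_unique (x y : L) k :
  new_atom x y (at_ k) ->
  (forall j, new_atom x y (at_ j) -> k <= j) -> lab x y = k.
Proof.
move=> hk hmin; apply/eqP; rewrite eqn_leq lab_min //=; apply/hmin/labP.
by move: hk => /and3P[_ ay]; apply: contra => /(le_trans ay).
Qed.

Lemma covers_lab (x y : L) : covers x y -> x \v at_ (lab x y) = y.
Proof.
move=> c; have /labP/and3P[_ ay ax] : ~~ (y <=% x) by rewrite lt_geF // coversW.
exact: covers_join_eq.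
Qed.

Lemma covers_labP (x y : L) : covers x y -> new_atom x y (at_ (lab x y)).
Proof. by move=> c; apply: labP; rewrite lt_geF // coversW. Qed.

(** Label words of the saturated chains of length [n] from [x]; these chains end at [top] when [n]
    is the corank of [x]. *)
Fixpoint words (n : nat) (x : L) : seq (seq nat) :=
  if n is n'.+1 then [seq lab x y :: w | y <- enum (covers x), w <- words n' y]
  else [:: [::]].

Lemma mem_words_cons n x a w :
  reflect (exists y, [/\ covers x y, a = lab x y & w \in words n y])
          (a :: w \in words n.+1 x).
Proof.
apply: (iffP allpairsPdep) => [[y [u [hy hu [-> ->]]]]|[y [c -> hw]]].
  by exists y; split => //; rewrite mem_enum in hy.
by exists y, w; rewrite mem_enum.
Qed.

Lemma words_size n x w : w \in words n x -> size w = n.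
Proof.
elim: n x w => [|n IH] x [|a w]; rewrite ?inE //.
  by move=> /allpairsPdep[? [? []]].
by move=> /mem_words_cons[y [_ _ /IH]] /= ->.
Qed.

Lemma words_notin n x w : w \in words n x -> all (fun k => ~~ (at_ k <=% x)) w.
Proof.
elim: n x w => [|n IH] x [|a w] //.
move=> /mem_words_cons[y [c -> /IH]] /= h.
have /and3P[_ _ -> /=] := covers_labP c.
apply: sub_all h => k; apply: contra => /le_trans; apply; exact/ltW/coversW.
Qed.

Lemma words_uniq_word n x w : w \in words n x -> uniq w.
Proof.
elim: n x w => [|n IH] x [|a w] //.
move=> /mem_words_cons[y [c -> hw]] /=; rewrite (IH _ _ hw) andbT.
apply/negP => /(allP (words_notin hw)).
by have /and3P[_ ->] := covers_labP c.
Qed.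

(** By [covers_lab] the labels recover the chain one step at a time. *)
Lemma uniq_words n x : uniq (words n x).
Proof.
elim: n x => //= n IH x; apply: allpairs_uniq_dep.
- exact: enum_uniq.
- by move=> y _; apply: IH.
move=> _ _ /allpairsPdep[y [u [hy _ ->]]] /allpairsPdep[z [v [hz _ ->]]] /=.
rewrite mem_enum in hy; rewrite mem_enum in hz.
by move=> [e <-]; have := covers_lab hz; rewrite -e covers_lab // => ->.
Qed.

(** The chain [x < y < z] labelled [a], [b] is replaced by [x < y' < z] with [y'] the join of [x]
    and the atom [b]; the rest of the chain is kept. *)
Lemma words_swap n x a b s :
  a < b -> a :: b :: s \in words n x -> b :: a :: s \in words n x.
Proof.
case: n => [|[|n]] // ab; first by move=> /words_size.
move=> /mem_words_cons[y [cxy ea /mem_words_cons[z [cyz eb hs]]]].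
have := covers_labP cxy; rewrite -ea => /and3P[atom_a ay ax].
have := covers_labP cyz; rewrite -eb => /and3P[atom_b bz b_y].
have xy := ltW (coversW cxy); have yz := ltW (coversW cyz).
have bx : ~~ (at_ b <=% x) by apply: contra b_y => /le_trans; apply.
set y' := x \v at_ b; have cxy' : covers x y' by apply: covers_join_atom.
have y'z : y' <=% z by rewrite leUx bz (le_trans xy yz).
(* Otherwise joining [c] to [x] would give both [y] and [y'], putting the atom [b] below [y]. *)
have meet_x c : c <=% y -> c <=% y' -> c <=% x.
  move=> cy cy'; apply: contraR b_y => cx.
  have -> : y = y' by rewrite -(covers_join_eq cxy cy cx) -(covers_join_eq cxy' cy' cx).
  exact: leUr.
have ay' : ~~ (at_ a <=% y') by apply: contra ax => /(meet_x _ ay).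
(* As [b] is the first atom of [z] not below [y], an earlier one is below [y], hence not before
   [a]. *)
have minz c : new_atom x z (at_ c) -> c < b -> at_ c <=% y /\ a <= c.
  move=> /and3P[ac cz cx] cb.
  have cy : at_ c <=% y.
    apply: contraLR cb; rewrite -leqNgt => cy.
    by rewrite eb lab_min // /new_atom /= ac cz cy.
  by split=> //; rewrite ea lab_min // /new_atom /= ac cy cx.
have ez : y' \v at_ a = z.
  rewrite /y' -joinA (joinC (at_ b)) joinA {1}ea covers_lab // eb covers_lab //.
apply/mem_words_cons; exists y'; split=> //.
  apply/esym/lab_unique; first by rewrite /new_atom /= atom_b leUr bx.
  move=> c /and3P[ac cy' cx]; rewrite leqNgt; apply/negP => cb.
  have [|cy _] := minz c _ cb; first by rewrite /new_atom /= ac cx (le_trans cy').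
  by rewrite (meet_x _ cy cy') in cx.
apply/mem_words_cons; exists z; split=> //.
  by rewrite -ez; apply: covers_join_atom.
apply/esym/lab_unique; first by rewrite /new_atom /= atom_a ay' (le_trans ay yz).
move=> c /and3P[ac cz cy']; have [cb|bc] := ltnP c b; last exact: ltnW (leq_trans ab bc).
apply: (minz c _ cb).2; rewrite /new_atom /= ac cz.
by apply: contra cy' => /le_trans; apply; exact: leUl.
Qed.

Lemma words_swap_closed n x : swap_closed (mem (words n x)).
Proof.
move=> p a b s ab; elim: p n x => [|c p IH] n x /=; first exact: words_swap.
case: n => // n /mem_words_cons[y [cy ec /IH h]].
by apply/mem_words_cons; exists y.
Qed.

(** * Chains and their greedy completion *)

Definition chains_above (x : L) : {set {set L}} :=
  [set S : {set L} | (S \subset [set z | (x <% z) && (z != top)]) && is_chain S].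

(* The empty chain has [first set0 = top]. *)
Definition first (S : {set L}) : L := (\meet_(z in S) z)%O.

Lemma chainP (S : {set L}) :
  reflect {in S &, forall y z, (y <=% z) || (z <=% y)} (is_chain S).
Proof.
apply: (iffP forall_inP) => h y; first by move=> z yS zS; apply: (forall_inP (h y yS)).
by move=> yS; apply/forall_inP => z zS; apply: h.
Qed.

Lemma chains_aboveP x (S : {set L}) :
  reflect ({in S, forall z, (x <% z) && (z != top)} /\
           {in S &, forall y z, (y <=% z) || (z <=% y)})
          (S \in chains_above x).
Proof.
rewrite inE; apply: (iffP andP) => -[hS /chainP hc]; split=> //.
  by move=> z /(subsetP hS); rewrite inE.
by apply/subsetP => z /hS; rewrite inE.
Qed.

Lemma first_le (S : {set L}) z : z \in S -> first S <=% z.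
Proof. exact: meets_inf. Qed.

Lemma first_mem x (S : {set L}) :
  S \in chains_above x -> (first S == top) || (first S \in S).
Proof.
move=> /chains_aboveP[_ hc].
have [->|[z0 hz0]] := set_0Vmem S; first by rewrite /first big_set0 eqxx.
(* An element of least rank is the minimum of the chain. *)
have [z zS0 zmin] := arg_minnP rho hz0; have zS : z \in S by [].
suff <- : z = first S by rewrite zS orbT.
apply/le_anti; rewrite first_le // andbT; apply/meetsP => y yS.
have /orP[//|yz] := hc z y zS yS.
have [->|ne] := eqVneq y z; first by [].
have /rho_lt : y <% z by rewrite lt_neqAle ne.
by rewrite ltnNge (zmin _ yS).
Qed.

Lemma first_gt x (S : {set L}) : x <% top -> S \in chains_above x -> x <% first S.
Proof.
move=> xt hS; have /orP[/eqP -> //|fS] := first_mem hS.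
by have /chains_aboveP[/(_ _ fS)/andP[]] := hS.
Qed.

Lemma card_chains_above x n (S : {set L}) :
  rho x + n.+1 = rho top -> S \in chains_above x -> #|S| <= n.
Proof.
move=> hx /chains_aboveP[hS hc].
(* Ranks are distinct along a chain and lie strictly between those of [x] and [top]. *)
rewrite cardE -(size_map rho) -(size_iota (rho x).+1 n).
apply: uniq_leq_size.
  rewrite map_inj_in_uniq ?enum_uniq // => y z; rewrite !mem_enum => yS zS e.
  apply/eqP; apply: contraTT (hc y z yS zS) => ne; rewrite negb_or.
  apply/andP; split; apply/negP => h.
    by have /rho_lt : y <% z by [rewrite lt_neqAle ne]; rewrite e ltnn.
  by have /rho_lt : z <% y by [rewrite lt_neqAle eq_sym ne]; rewrite e ltnn.
move=> k /mapP[z]; rewrite mem_enum => /hS /andP[/rho_lt xz zt] ->.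
have /rho_lt : z <% top by rewrite ltx1.
rewrite mem_iota xz -hx; lia.
Qed.

(** Stopping at the first new atom keeps the label: every new atom below [x'] is also below [y]. *)
Lemma join_lab (x y : L) :
  x <% y -> let x' := x \v at_ (lab x y) in
  [/\ covers x x', x' <=% y & lab x x' = lab x y].
Proof.
move=> xy; have /labP/and3P[aa ay ax] : ~~ (y <=% x) by rewrite lt_geF.
have x'y : x \v at_ (lab x y) <=% y by rewrite leUx ay ltW.
split=> //; first exact: covers_join_atom.
apply: lab_unique; first by rewrite /new_atom /= aa leUr ax.
move=> j /and3P[aj jx' jx]; apply: lab_min.
by rewrite /new_atom /= aj jx (le_trans jx').
Qed.

(* The first step of the greedy completion of the chain [S] above [x]. *)
Definition next (x : L) (S : {set L}) : L := x \v at_ (lab x (first S)).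

Lemma next_mem (x y : L) (S : {set L}) : covers x y -> y != top -> y \in S ->
  (S \in chains_above x) && (next x S == y) = (S :\ y \in chains_above y).
Proof.
move=> cxy yt yS; have xy := coversW cxy.
apply/andP/idP => [[hS /eqP hn]|].
  have xt : x <% top by rewrite (lt_le_trans xy) ?lex1.
  have [_ nf _] := join_lab (first_gt xt hS).
  have /chains_aboveP[h1 h2] := hS.
  apply/chains_aboveP; split=> [z|z t]; rewrite !inE.
    move=> /andP[zy zS]; have /andP[_ ->] := h1 z zS.
    rewrite andbT lt_neqAle eq_sym zy /= -hn.
    by apply: le_trans nf _; apply: first_le.
  by move=> /andP[_ zS] /andP[_ tS]; apply: h2.
move=> /chains_aboveP[h1 h2].
have yle z : z \in S -> y <=% z.
  move=> zS; have [->//|zy] := eqVneq z y.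
  by apply: ltW; have /andP[] := h1 z (introT setD1P (conj zy zS)).
have fy : first S = y.
  by apply/le_anti; rewrite first_le //=; apply/meetsP.
split; last by rewrite /next fy covers_lab.
apply/chains_aboveP; split=> [z zS|z t zS tS].
  have [->|zy] := eqVneq z y; first by rewrite xy.
  by rewrite (lt_le_trans xy) ?yle //; have /andP[] := h1 z (introT setD1P (conj zy zS)).
have [->|zy] := eqVneq z y; first by rewrite yle.
have [->|ty] := eqVneq t y; first by rewrite yle // orbT.
by apply: h2; apply/setD1P.
Qed.

(** The completion inserts [y] into a chain avoiding it exactly when the first new atom below
    [first S] already lies below [y], that is, when the next label is larger. *)
Lemma next_notin (x y : L) (S : {set L}) : covers x y -> y != top ->
  [&& S \in chains_above x, next x S == y & y \notin S] =
  (S \in chains_above y) && (lab x y < lab y (first S)).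
Proof.
move=> cxy yt; have xy := coversW cxy.
have xt : x <% top by rewrite (lt_le_trans xy) ?lex1.
have ytop : y <% top by rewrite ltx1.
have /and3P[ay_atom ay ax] := covers_labP cxy.
apply/and3P/andP => [[hS /eqP hn yS]|[hS hlt]].
  have [_ nf el] := join_lab (first_gt xt hS); move: nf el; rewrite -/(next x S) hn => nf el.
  have hS' : S \in chains_above y.
    have /chains_aboveP[h1 h2] := hS.
    apply/chains_aboveP; split=> // z zS; have /andP[_ ->] := h1 z zS.
    rewrite andbT lt_neqAle (le_trans nf) ?first_le // andbT.
    by apply: contraNneq yS => ->.
  split=> //; have /labP/and3P[b1 b2 b3] : ~~ (first S <=% y).
    by rewrite lt_geF // first_gt.
  rewrite ltn_neqAle; apply/andP; split.
    by apply: contraNneq b3 => <-.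
  rewrite el lab_min // /new_atom /= b1 b2 /=.
  by apply: contra b3 => /le_trans; apply; exact: ltW.
have yf := first_gt ytop hS.
have /chains_aboveP[h1 h2] := hS.
split.
- apply/chains_aboveP; split=> // z zS; have /andP[yz ->] := h1 z zS.
  by rewrite (lt_trans xy).
- suff e : lab x (first S) = lab x y by rewrite /next e covers_lab.
  apply: lab_unique; first by rewrite /new_atom /= ay_atom ax (le_trans ay (ltW yf)).
  move=> j /and3P[j1 j2 j3].
  have [jy|jy] := boolP (at_ j <=% y).
    by rewrite lab_min // /new_atom /= j1 jy j3.
  by rewrite (leq_trans (ltnW hlt)) // lab_min // /new_atom /= j1 j2 jy.
by apply/negP => /h1; rewrite ltxx.
Qed.

(** * The h-polynomial as a sum over label words *)

Local Open Scope ring_scope.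

(** A chain above [y] arises once with [y] added, with factor 1, and at an ascent also without [y],
    with factor ['X - 1]; the total is ['X] at an ascent and 1 otherwise. *)
Lemma sum_chains_next (x y : L) n : covers x y -> (rho y + n.+1)%N = rho top ->
  \sum_(S in chains_above x | next x S == y) ('X - 1) ^+ (n.+1 - #|S|) =
  \sum_(S in chains_above y) ('X - 1) ^+ (n - #|S|) *
    (if (lab x y < lab y (first S))%N then 'X else 1) :> {poly int}.
Proof.
move=> cxy hy; have yt : y != top.
  by rewrite -ltx1 lt_top // -hy; lia.
rewrite (bigID (fun S : {set L} => y \in S)) /=.
rewrite (reindex_onto (fun S : {set L} => y |: S) (fun S => S :\ y)) /=; last first.
  by move=> S /andP[_ yS]; rewrite setD1K.
have -> : \sum_(S | (((y |: S \in chains_above x) && (next x (y |: S) == y))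
             && (y \in y |: S)) && ((y |: S) :\ y == S)) ('X - 1) ^+ (n.+1 - #|y |: S|) =
          \sum_(S in chains_above y) ('X - 1) ^+ (n - #|S|) :> {poly int}.
  have eqc S : (((y |: S \in chains_above x) && (next x (y |: S) == y))
             && (y \in y |: S)) && ((y |: S) :\ y == S) = (S \in chains_above y).
    rewrite setU11 andbT next_mem ?setU11 //.
    apply/andP/idP => [[h /eqP e]|h]; first by rewrite -e.
    suff -> : (y |: S) :\ y = S by [].
    by rewrite setU1K //; apply/negP; have /chains_aboveP[h1 _] := h => /h1; rewrite ltxx.
  rewrite (eq_bigl _ _ eqc); apply: eq_bigr => S hS.
  rewrite cardsU1; have -> : y \notin S.
    by apply/negP; have /chains_aboveP[h1 _] := hS => /h1; rewrite ltxx.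
  by rewrite add1n subSS.
have -> : \sum_(S | ((S \in chains_above x) && (next x S == y)) && (y \notin S))
            ('X - 1) ^+ (n.+1 - #|S|) =
          \sum_(S in chains_above y | (lab x y < lab y (first S))%N)
            ('X - 1) ^+ (n - #|S|) * ('X - 1) :> {poly int}.
  apply: eq_big => [S|S]; first by rewrite -andbA next_notin.
  rewrite -andbA next_notin // => /andP[hS _].
  by rewrite -exprSr subSn // (card_chains_above hy).
rewrite [X in _ + X]big_mkcondr -big_split /=; apply: eq_bigr => S _.
by case: ifP; rewrite ?mulr1 ?addr0 // mulrBr mulr1 addrC subrK.
Qed.

(* The weight [g] of the first label is what lets the induction see whether the
   label prepended to a word creates an ascent. *)
Lemma sum_chains_words n x (g : nat -> {poly int}) :
  (rho x + n.+1)%N = rho top ->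
  \sum_(S in chains_above x) ('X - 1) ^+ (n - #|S|) * g (lab x (first S)) =
  \sum_(w <- words n.+1 x) 'X^(asc w) * g (head 0%N w).
Proof.
elim: n x g => [|n IH] x g hx.
  have xt : x <% top by apply: lt_top; rewrite -hx; lia.
  have cxt : covers x top by apply: covers_rho; rewrite // -hx addn1.
  rewrite [RHS]big_allpairs_dep big_enum /=.
  rewrite (big_pred1 (set0 : {set L})) => [|S]; last first.
    apply/idP/eqP => [hS|->].
      by apply/eqP; rewrite -cards_eq0 -leqn0 (card_chains_above hx).
    by apply/chains_aboveP; split=> z; rewrite inE.
  rewrite (big_pred1 top) => [|y]; last first.
    apply/idP/eqP => [/coversW xy|-> //].
    by apply: (covers_between cxt) => //; exact: lex1.
  by rewrite big_seq1 /first big_set0 sub0n.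
have xt : x <% top by apply: lt_top; rewrite -hx; lia.
rewrite [RHS]big_allpairs_dep big_enum /=.
rewrite (partition_big (next x) (covers x)) /=; last first.
  by move=> S hS; have [] := join_lab (first_gt xt hS).
apply: eq_bigr => y cy.
have hy : (rho y + n.+1)%N = rho top by rewrite (rho_covers cy) addSnnS.
transitivity ((\sum_(S in chains_above x | next x S == y)
                ('X - 1) ^+ (n.+1 - #|S|)) * g (lab x y)).
  rewrite mulr_suml; apply: eq_bigr => S /andP[hS /eqP hn].
  have [_ _] := join_lab (first_gt xt hS); by rewrite -/(next x S) hn => ->.
rewrite sum_chains_next // (IH y (fun b => if (lab x y < b)%N then 'X else 1)) //.
rewrite mulr_suml [LHS]big_seq [RHS]big_seq; apply: eq_bigr => w /words_size.
case: w => // b w _ /=; case: ifP => _; last by rewrite mulr1.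
by rewrite add1n exprSr.
Qed.

Lemma chains_aboveE (S : {set L}) :
  (S \in chains_above bot) = (S \subset proper_part) && is_chain S.
Proof.
rewrite inE; congr (_ && _); apply: eq_subset_r => z.
by rewrite !inE lt0x.
Qed.

Lemma fpoly_words r : rho top = r.+1 ->
  fpoly (L := L) r = \sum_(w <- words r.+1 bot) 'X^(asc w).
Proof.
move=> hr; have h0 : (rho bot + r.+1)%N = rho top by case: geomL => -[-> _].
transitivity (\sum_(S in chains_above bot) ('X - 1) ^+ (r - #|S|) : {poly int}); last first.
  have := sum_chains_words (fun=> 1) h0.
  by under eq_bigr do rewrite mulr1; under [in RHS]eq_bigr do rewrite mulr1.
(* Faces are grouped by size; [inord] is faithful because a face has at most [r] vertices. *)
rewrite (partition_big (fun S : {set L} => inord #|S| : 'I_r.+1) xpredT) //=.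
apply: eq_bigr => i _; rewrite scaler_nat -sumr_const /fnum.
apply: eq_big => [S|S]; rewrite inE andbA -chains_aboveE.
  have [hS|] //= := boolP (S \in chains_above bot).
  have hc := card_chains_above h0 hS.
  by rewrite -val_eqE /= inordK.
by move=> /andP[_ /eqP ->].
Qed.

(** A word of [r.+1] distinct letters with [r - k] ascents has [k] descents. *)
Lemma hnum_words r k : rho top = r.+1 -> (k <= r)%N ->
  hnum (L := L) r k = (count (fun w => des w == k) (words r.+1 bot))%:R.
Proof.
move=> hr kr; rewrite /hnum fpoly_words // coef_sum -sum1_count natr_sum.
rewrite [RHS]big_mkcond [LHS]big_seq [RHS]big_seq; apply: eq_bigr => w hw.
rewrite coefXn; have := asc_des (words_uniq_word hw); rewrite (words_size hw) /=.
by case: eqP; case: eqP => //; lia.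
Qed.

Lemma hnum_le r i k : rho top = r.+1 -> (i.*2 + k <= r)%N ->
  hnum (L := L) r i <= hnum (L := L) r (i + k).
Proof.
move=> hr h; rewrite !hnum_words //; [|lia..].
rewrite ler_nat; apply: (@count_des_le _ r); rewrite ?uniq_words //.
- exact: words_uniq_word.
- exact: words_size.
- exact: words_swap_closed.
Qed.

End GeometricLattice.

Theorem theorem1p1 (disp : Order.disp_t) (L : finTBLatticeType disp)
    (rho : L -> nat) (r : nat) :
  geometric rho -> rho (\top)%O = r.+1 ->
  forall i : nat, (1 <= i)%N -> (i.*2 <= r)%N ->
    ((hnum (L:=L) r i.-1 <= hnum (L:=L) r i)%R /\
     (hnum (L:=L) r i <= hnum (L:=L) r (r - i))%R).
Proof.
move=> geomL hr i i1 ir; split.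
  (* Both inequalities are cases of [hnum_le]: here a step of 1 from [i.-1], below the step
     [r - i.*2] from [i]. *)
  by have := @hnum_le _ _ _ geomL r i.-1 1 hr; rewrite (addn1 i.-1) prednK //; apply; lia.
have -> : (r - i = i + (r - i.*2))%N by lia.
by apply: (hnum_le geomL hr); lia.
Qed.
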